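(* Let $\mathcal{E}$ be a complex Hilbert space, let $\varphi:\mathcal{E}\to\mathcal{E}$, $\varphi(z)=Az+b$, satisfy property $\mathcal{P}$ with $A^*b=0$, and let $w_0\in\mathcal{E}$ with $\|w_0\|=1$. Then $A$ attains its norm at $w_0$ and $\|A\|=1$ if and only if $C_\varphi^*$ attains its norm at $k_{w_0}$.
   Context: Inner products are linear in the first variable. For a complex Hilbert space $\mathcal{E}$, the Segal-Bargmann space $\mathcal{H}(\mathcal{E})$ is the reproducing kernel Hilbert space of (entire) functions on $\mathcal{E}$ with reproducing kernel $K(z,w)=K_w(z)=\exp\langle z,w\rangle$, $z,w\in\mathcal{E}$; thus $\langle f,K_w\rangle=f(w)$ for $f\in\mathcal{H}(\mathcal{E})$. The normalized kernel function is $k_w=K_w/\|K_w\|$, i.e. $k_w(z)=\exp\left(\langle z,w\rangle-\frac{\|w\|^2}{2}\right)$. For a mapping $\varphi:\mathcal{E}\to\mathcal{E}$, the composition operator is $C_\varphi f=f\circ\varphi$. The map $\varphi$ has property $\mathcal{P}$ if: (i) $\varphi(z)=Az+b$ for all $z\in\mathcal{E}$; (ii) $A:\mathcal{E}\to\mathcal{E}$ is a bounded linear operator with $\|A\|\le 1$ and $b\in\mathcal{E}$; (iii) $A^*b$ belongs to the range of $(I-A^*A)^{1/2}$, and $v$ denotes the unique element of $\mathcal{E}$ of smallest norm such that $(I-A^*A)^{1/2}v=A^*b$. Property $\mathcal{P}$ is equivalent to boundedness of $C_\varphi$ on $\mathcal{H}(\mathcal{E})$. A bounded operator $T$ on a Hilbert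 space attains its norm at a unit vector $x$ if $\|Tx\|=\|T\|$. *)

(* Defs.v *)
From HB Require Import structures.
From mathcomp Require Import all_boot all_order all_algebra.
From mathcomp Require Import all_classical all_reals all_analysis.
From mathcomp Require Import complex.

Set Implicit Arguments.
Unset Strict Implicit.
Unset Printing Implicit Defensive.

Import Order.TTheory GRing.Theory Num.Theory.
Import numFieldNormedType.Exports.

Local Open Scope classical_set_scope.
Local Open Scope ring_scope.
Local Open Scope complex_scope.

(* {dot E for conjC} is linear in the first variable and conjugate-linear in
   the second.  The norm of E has values in R[i] (nonnegative reals). *)
HB.mixin Record CompleteNormedModule_isHilbert (R : realType) (E : Type)
    of CompleteNormedModule R[i] E := {
  inner : {dot E for (@Num.conj R[i])};
  inner_norm : forall x : E, inner x x = `|x| ^+ 2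
}.

#[short(type="hilbertType")]
HB.structure Definition Hilbert (R : realType) :=
  {E of CompleteNormedModule R[i] E & CompleteNormedModule_isHilbert R E}.

Section Operators.
Context {R : realType}.

(* Extended-real valued: +oo exactly for unbounded maps, when T is linear. *)
Definition opnorm {U V : hilbertType R} (T : U -> V) : \bar R :=
  ereal_sup [set (complex.Re `|T x|)%:E | x in [set x : U | `|x| <= 1]].

Definition bounded_linear {U V : hilbertType R} (T : U -> V) : Prop :=
  linear T /\ (opnorm T < +oo)%E.

Definition attains_norm {U V : hilbertType R} (T : U -> V) (x : U) : Prop :=
  `|x| = 1 /\ (complex.Re `|T x|)%:E = opnorm T.

(* T^*; the value 0 is only taken when T has no adjoint, which by Riesz's
   theorem does not happen for bounded linear T. *)
Definition adjoint {U V : hilbertType R} (T : U -> V) : V -> U :=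
  xget (fun=> 0) [set S | forall x y, inner (T x) y = inner x (S y)].

(* The positive square root of a bounded positive operator (unique when it
   exists, and it exists when T is bounded and positive). *)
Definition sqrt_op {U : hilbertType R} (T : U -> U) : U -> U :=
  xget (fun=> 0) [set S | [/\ bounded_linear S,
    forall x, 0 <= inner (S x) x & forall x, S (S x) = T x]].

Definition defect {U : hilbertType R} (A : U -> U) : U -> U :=
  sqrt_op (fun x => x - adjoint A (A x)).

Definition property_P {E : hilbertType R} (phi A : E -> E) (b : E) : Prop :=
  [/\ forall z, phi z = A z + b,
      bounded_linear A /\ (opnorm A <= 1)%E
    & exists v, defect A v = adjoint A b].

Definition cexp (z : R[i]) : R[i] :=
  (expR (complex.Re z) * cos (complex.Im z))
    +i* (expR (complex.Re z) * sin (complex.Im z)).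

End Operators.

(* A reproducing kernel Hilbert space on X with kernel K: a Hilbert space whose
   elements are identified, by the injective linear map rkhs_eval, with functions
   on X.  By Moore-Aronszajn it exists for each positive definite K and is
   unique up to a unitary that respects rkhs_eval. *)
Record rkhs (R : realType) (X : Type) (K : X -> X -> R[i]) := Rkhs {
  rkhs_space :> hilbertType R;
  rkhs_eval : rkhs_space -> X -> R[i];
  rkhs_eval_linear : forall (a : R[i]) f g x,
    rkhs_eval (a *: f + g) x = a * rkhs_eval f x + rkhs_eval g x;
  rkhs_eval_inj : injective rkhs_eval;
  rkhs_kernel : X -> rkhs_space;
  rkhs_kernelE : forall w z, rkhs_eval (rkhs_kernel w) z = K z w;
  rkhs_reproducing : forall f w, inner f (rkhs_kernel w) = rkhs_eval f w
}.

Section SegalBargmann.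
Context {R : realType} (E : hilbertType R).

Definition sb_kernel (z w : E) : R[i] := cexp (inner z w).

Definition segal_bargmann := rkhs sb_kernel.

Definition normalized_kernel (H : segal_bargmann) (w : E) : H :=
  (`|rkhs_kernel H w|)^-1 *: rkhs_kernel H w.

(* C_phi; the value 0 is only taken at those f for which the function f o phi
   does not belong to H. *)
Definition composition_op (H : segal_bargmann) (phi : E -> E) : H -> H :=
  fun f => xget 0 [set g | rkhs_eval g = rkhs_eval f \o phi].

End SegalBargmann.

Arguments normalized_kernel {R E} H w.
Arguments composition_op {R E} H phi f.

(* Main.v *)
Require Import Defs.
From mathcomp Require Import all_boot all_order all_algebra.
From mathcomp Require Import all_classical all_reals all_analysis.
From mathcomp Require Import complex ring lra.
Import Order.TTheory GRing.Theory Num.Theory.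
Import numFieldNormedType.Exports.
Local Open Scope ring_scope.
Set Implicit Arguments.
Unset Strict Implicit.
Unset Printing Implicit Defensive.
Local Open Scope complex_scope.
Local Open Scope classical_set_scope.

(** The adjoint of the composition operator acts on kernel functions by
    [C_phi^* K_w = K_(phi w)], and [|K_w|^2 = exp (|w|^2)].  Since [A^* b = 0],
    the vector [b] is orthogonal to the range of [A], whence
    [|phi w|^2 = |A w|^2 + |b|^2] and
    [|C_phi^* k_w|^2 = exp (|A w|^2 + |b|^2 - |w|^2)].  If the operator norm of
    [C_phi^*] is [exp (|b|^2 / 2)], then for a unit vector [w0] the norm is
    attained at [k_(w0)] exactly when [|A w0| = 1].  As [A] is a contraction,
    this means that [|A| = 1] and that [A] attains its norm at [w0].

    The lower bound for the operator norm is its value at [K_0].  The upper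
    bound, together with the existence of [C_phi], comes from positivity of
    kernels.  For a contraction [A] the kernel [<w_i, w_j> - <A w_i, A w_j>] is
    positive semidefinite ([psd_contraction_gram]); Schur's product theorem
    ([psdM]) and the limit [exp z = lim (1 + z / n)^n] ([cexp_limit]) transfer
    this to [exp <w_i, w_j> - exp <A w_i, A w_j>] ([psd_cexpD_sub]).  Hence
    [K_w |-> K_(phi w)] is bounded by [exp (|b|^2 / 2)] on the span of the
    kernel functions ([kernel_sum_bound]), and Riesz's theorem on that span
    ([riesz_graph]) yields [f \o phi] as an element of the space
    ([composition_exists]) with the same bound on its norm.  The same form of
    Riesz's theorem provides the adjoints. *)

(** * Inner products and norms *)

Section HilbertGeometry.
Context {R : realType} {E : hilbertType R}.
Implicit Types (x y z u v : E) (a : R[i]).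

(** The norm takes values in [R[i]]; estimates that multiply or compare norms
    are done on this real copy of it, where the order is total. *)
Definition rnorm x : R := complex.Re `|x|.

Lemma norm_rnorm x : `|x| = (rnorm x)%:C.
Proof. by rewrite /rnorm RRe_real// normr_real. Qed.

Lemma rnorm_ge0 x : 0 <= rnorm x.
Proof. by rewrite -ler0c -norm_rnorm. Qed.

Lemma innerC x y : inner y x = ((inner x y)^*)%C.
Proof. by have := hermC (@inner R E) y x; rewrite expr0 mul1r. Qed.

Lemma innerDl x y z : inner (x + y) z = inner x z + inner y z.
Proof. by rewrite linearDl. Qed.
Lemma innerZl a x z : inner (a *: x) z = a * inner x z.
Proof. by rewrite linearZl_LR. Qed.
Lemma innerDr x y z : inner z (x + y) = inner z x + inner z y.
Proof. by rewrite linearDr. Qed.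
Lemma innerZr a x z : inner z (a *: x) = (a^*)%C * inner z x.
Proof. by rewrite linearZr_LR. Qed.
Lemma innerNl x z : inner (- x) z = - inner x z.
Proof. by rewrite linearNl. Qed.
Lemma innerNr x z : inner z (- x) = - inner z x.
Proof. by rewrite linearNr. Qed.
Lemma inner0l z : inner 0 z = 0.
Proof. by rewrite linear0l. Qed.
Lemma inner0r z : inner z 0 = 0.
Proof. by rewrite linear0r. Qed.

Lemma inner_rnorm x : inner x x = (rnorm x ^+ 2)%:C.
Proof. by rewrite inner_norm norm_rnorm rmorphXn. Qed.

Lemma Re_innerC x y : complex.Re (inner y x) = complex.Re (inner x y).
Proof. by rewrite innerC; case: (inner x y). Qed.

Lemma rnormD_sqr x y :
  rnorm (x + y) ^+ 2 = rnorm x ^+ 2 + 2 * complex.Re (inner x y) + rnorm y ^+ 2.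
Proof.
apply: (@complexI R); rewrite -inner_rnorm innerDl !innerDr !inner_rnorm.
rewrite (innerC x y); case: (inner x y) => a b /=.
by apply/eqP; rewrite eq_complex /=; apply/andP; split; apply/eqP; ring.
Qed.

(** Expand [0 <= inner z z] for [z = |y|^2 x - <x, y> y], the component of
    [x] orthogonal to [y] scaled so as to avoid a division. *)
Lemma cauchy_schwarz x y : `|inner x y| <= `|x| * `|y|.
Proof.
rewrite -(@ler_pXn2r _ 2) ?nnegrE ?mulr_ge0// exprMn -!inner_norm.
have [->|y0] := eqVneq y 0; first by rewrite !inner0r normr0 expr0n mulr0.
have N0 : 0 < inner y y by rewrite inner_norm exprn_gt0 ?normr_gt0.
rewrite -(ler_pM2l N0).
pose z := inner y y *: x - inner x y *: y.
have : 0 <= inner z z by rewrite inner_norm exprn_ge0.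
rewrite !(innerDl, innerDr, innerNl, innerNr, innerZl, innerZr).
have -> : inner y x = ((inner x y)^*)%C by exact: innerC.
have -> : ((inner y y)^*)%C = inner y y by rewrite -innerC.
rewrite sqr_normc.
move=> zz; rewrite -subr_ge0; apply: (le_trans zz).
by rewrite le_eqVlt; apply/orP; left; apply/eqP; ring.
Qed.

Lemma Re_inner_le x y : `|complex.Re (inner x y)| <= rnorm x * rnorm y.
Proof.
rewrite -lecR rmorphM /= -!norm_rnorm.
exact: le_trans (normc_ge_Re _) (cauchy_schwarz _ _).
Qed.

Lemma ReD (a b : R[i]) : complex.Re (a + b) = complex.Re a + complex.Re b.
Proof. by case: a b => ? ? []. Qed.

Lemma ReZ (t : R) (a : R[i]) : complex.Re (t%:C * a) = t * complex.Re a.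
Proof. by case: a => ? ? /=; rewrite mul0r subr0. Qed.

Lemma norm_i : `|'i%C : R[i]| = 1.
Proof. by rewrite normc_def /= expr0n expr1n add0r sqrtr1. Qed.

Lemma norm_realC (t : R) : `|t%:C| = `|t|%:C.
Proof. by rewrite normc_def /= expr0n /= addr0 sqrtr_sqr. Qed.

Lemma rnormZ (t : R) x : rnorm (t%:C *: x) = `|t| * rnorm x.
Proof. by apply: complexI; rewrite rmorphM /= -!norm_rnorm normrZ norm_realC. Qed.

Lemma ler_rnormD x y : rnorm (x + y) <= rnorm x + rnorm y.
Proof. by rewrite -lecR rmorphD /= -!norm_rnorm ler_normD. Qed.

(** Completeness with real radii: every positive element of [R[i]] is real, so
    balls of real radius generate the topology. *)
Lemma hilbert_complete (u : nat -> E) :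
  (forall e : R, 0 < e -> exists N, forall n m, (N <= n)%N -> (N <= m)%N ->
     rnorm (u n - u m) < e) ->
  exists g, forall e : R, 0 < e -> exists N, forall n, (N <= n)%N ->
     rnorm (u n - g) < e.
Proof.
move=> uC.
have toR (e : R[i]) : 0 < e -> 0 < complex.Re e /\ e = (complex.Re e)%:C.
  move=> e0; have eE : e = (complex.Re e)%:C by rewrite RRe_real ?gtr0_real.
  by split => //; rewrite -ltcR -eE.
have : cvg (u @ \oo).
  suff : cauchy_ex (u @ \oo) by move/cauchy_exP/cauchy_cvg.
  move=> e /toR[e0 ->]; have [N uN] := uC _ e0.
  exists (u N), N => // m /= Nm; rewrite -ball_normE /ball_ /=.
  by rewrite norm_rnorm ltcR uN.
move=> /cvg_ex[g /cvgrPdist_lt ug]; exists g => e e0.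
have [|N _ uN] := ug e%:C; first by rewrite ltcR.
by exists N => n /uN; rewrite distrC norm_rnorm ltcR.
Qed.

End HilbertGeometry.

(** * Riesz representation on a subspace *)

Lemma quadratic_ge0_linear_eq0 (R : realType) (a b : R) :
  (forall t, 0 <= 2 * t * a + t ^+ 2 * b) -> a = 0.
Proof.
move=> ab; have b0 : 0 <= b by have := ab 1; have := ab (-1); lra.
have b1 : 0 < b + 1 by lra.
(* The minimiser is - a / b; adding 1 to b keeps the argument valid at b = 0. *)
have := ab (- a / (b + 1)).
have -> : 2 * (- a / (b + 1)) * a + (- a / (b + 1)) ^+ 2 * b =
   - (a ^+ 2 * (b + 2)) / (b + 1) ^+ 2 by field; lra.
rewrite pmulr_lge0 ?invr_gt0 ?exprn_gt0// oppr_ge0 => a2.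
apply/eqP; rewrite -sqrf_eq0 eq_le sqr_ge0 andbT.
by rewrite -(@pmulr_lle0 _ (b + 2)) //; lra.
Qed.

Section Riesz.
Context {R : realType} {E : hilbertType R}.

(** Riesz's theorem for a bounded functional given by its graph [G].  A graph
    makes it possible to use functionals defined on the span of a family of
    vectors, without choosing a representation of each vector or extending the
    functional to the closure.  The representing vector is the limit of a
    minimising sequence of [J u l = |u|^2 - 2 Re l] over the graph: the
    parallelogram law makes the sequence Cauchy, and the first variation of [J]
    along the graph vanishes in the limit, which is the required identity. *)
Lemma riesz_graph (G : E -> R[i] -> Prop) (M : R) :
  0 <= M -> G 0 0 ->
  (forall a u l v m, G u l -> G v m -> G (a *: u + v) (a * l + m)) ->
  (forall u l, G u l -> `|l| <= M%:C * `|u|) ->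
  exists g, (rnorm g <= M) /\ forall u l, G u l -> inner u g = l.
Proof.
move=> M0 G0 Glin Gbnd.
pose J (u : E) (l : R[i]) : R := rnorm u ^+ 2 - 2 * complex.Re l.
pose D := [set r : R | exists u l, G u l /\ J u l = r].
have Re_le u l : G u l -> complex.Re l <= M * rnorm u.
  move=> /Gbnd; rewrite norm_rnorm -rmorphM => lM.
  by have := le_trans (normc_ge_Re l) lM; rewrite lecR;
    apply: le_trans (ler_norm _).
have Dlb : lbound D (- M ^+ 2).
  move=> _ [u [l [Gul <-]]]; rewrite /J.
  by have := Re_le _ _ Gul; have := sqr_ge0 (rnorm u - M); nra.
have Dinf : has_inf D.
  by split; [exists (J 0 0), 0, 0|exists (- M ^+ 2)].
have infD u l : G u l -> inf D <= J u l.
  by move=> Gul; apply: ge_inf => //; [case: Dinf|exists u, l].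
have minD n : exists p : E * R[i], G p.1 p.2 /\ J p.1 p.2 < inf D + n.+1%:R^-1.
  have [|_ [u [l [Gul <-]]] Jul] := inf_adherent _ Dinf (eps := n.+1%:R^-1).
    by rewrite invr_gt0 ltr0n.
  by exists (u, l).
have [p pP] := choice minD.
have Jmid u l v m : G u l -> G v m ->
    rnorm (u - v) ^+ 2 <= 2 * J u l + 2 * J v m - 4 * inf D.
  move=> Gul Gvm.
  have Gs : G (2^-1 *: (u + v)) (2^-1 * (l + m)).
    have := Glin 2^-1 _ _ _ _ (Glin 1 _ _ _ _ Gul Gvm) G0.
    by rewrite scale1r mul1r !addr0.
  have := infD _ _ Gs; rewrite /J.
  have -> : 2^-1 = (2^-1)%:C :> R[i] by rewrite fmorphV rmorph_nat.
  rewrite ReZ ReD rnormZ ger0_norm ?invr_ge0//.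
  have := rnormD_sqr u v; have := rnormD_sqr u (- v).
  rewrite innerNr.
  have -> : rnorm (- v) = rnorm v by rewrite /rnorm normrN.
  have -> : complex.Re (- inner u v) = - complex.Re (inner u v).
    by case: (inner u v).
  move=> -> h1 h2; nra.
have inv_small (e : R) : 0 < e ->
    exists N, forall n, (N <= n)%N -> n.+1%:R^-1 < e.
  move=> e0; exists (Num.truncn e^-1) => n Nn.
  rewrite -ltf_pV2 ?posrE ?invr_gt0 ?ltr0n// invrK.
  by apply: lt_le_trans (truncnS_gt _) _; rewrite ler_nat.
have [|g gP] := hilbert_complete (u := fun n => (p n).1).
  (* Jmid bounds |u n - u m|^2 by 2 / (n + 1) + 2 / (m + 1). *)
  move=> e e0; have [|N NP] := inv_small (e ^+ 2 / 4).
    by rewrite divr_gt0 ?exprn_gt0.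
  exists N => n m Nn Nm /=; rewrite -(@ltr_pXn2r _ 2) ?nnegrE ?rnorm_ge0 1?ltW//.
  have [Gn Jn] := pP n; have [Gm Jm] := pP m.
  have := Jmid _ _ _ _ Gn Gm; have := NP _ Nn; have := NP _ Nm; move: Jn Jm.
  move: (n.+1%:R^-1) (m.+1%:R^-1) (J _ _) (J _ _) (inf D) => *; lra.
(* Moving a near-minimiser by t v cannot lower J in the limit. *)
have Re_eq v m : G v m -> complex.Re (inner g v) = complex.Re m.
  move=> Gvm; apply/eqP; rewrite -subr_eq0; apply/eqP.
  apply: (@quadratic_ge0_linear_eq0 _ _ (rnorm v ^+ 2)) => t.
  apply/ler_addgt0Pl => e e0.
  (* Half of e pays for J - inf, the other half for 2 t Re <u n - g, v>. *)
  have [|N1 N1P] := inv_small (e / 2); first by lra.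
  have t1 : 0 < 4 * (`|t| * rnorm v + 1).
    by rewrite mulr_gt0// ltr_wpDl// mulr_ge0 ?rnorm_ge0.
  have [|N2 N2P] := gP (e / (4 * (`|t| * rnorm v + 1))).
    by rewrite divr_gt0.
  pose n := maxn N1 N2.
  have := N1P n (leq_maxl _ _); have := N2P n (leq_maxr _ _).
  rewrite ltr_pdivlMr// => gn n1.
  have [Gn Jn] := pP n.
  have Gt : G ((p n).1 + t%:C *: v) ((p n).2 + t%:C * m).
    by have := Glin t%:C _ _ _ _ Gvm Gn; rewrite addrC [in X in _ -> G _ X]addrC.
  have := infD _ _ Gt; rewrite /J rnormD_sqr innerZr.
  rewrite rnormZ exprMn real_normK ?num_real// conjc_real ReZ ReD ReZ.
  have -> : complex.Re (inner (p n).1 v) =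
      complex.Re (inner g v) + complex.Re (inner ((p n).1 - g) v).
    by rewrite -ReD -innerDl addrC subrK.
  have : t * complex.Re (inner ((p n).1 - g) v) <=
      `|t| * (rnorm ((p n).1 - g) * rnorm v).
    apply: le_trans (ler_norm _) _; rewrite normrM ler_wpM2l//.
    exact: Re_inner_le.
  have := rnorm_ge0 ((p n).1 - g).
  move: Jn; rewrite /J; move: n1 gn.
  move: (n.+1%:R^-1) (rnorm (_ - g)) (inf D) => *; nra.
(* The imaginary parts agree by the same identity applied to i v. *)
have inner_eq v m : G v m -> inner v g = m.
  move=> Gvm.
  have Gi : G ('i%C *: v) ('i%C * m).
    by have := Glin 'i%C _ _ _ _ Gvm G0; rewrite !addr0.
  have := Re_eq _ _ Gvm; have := Re_eq _ _ Gi; rewrite Re_innerC innerZl.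
  rewrite (Re_innerC v g).
  case: (inner v g) (m) => a b [c d] /= ? ?; apply/eqP; rewrite eq_complex /=.
  by apply/andP; split; apply/eqP; lra.
exists g; split => //.
(* |g|^2 is close to <u_n, g> = l_n, which is at most M |u_n|. *)
have [->|g0] := eqVneq (rnorm g) 0; first by [].
have g1 : 0 < rnorm g by rewrite lt_def g0 rnorm_ge0.
rewrite -(ler_pM2r g1).
apply/ler_addgt0Pl => e e0.
have t1 : 0 < rnorm g + M by lra.
have [|N NP] := gP (e / (rnorm g + M)); first by rewrite divr_gt0.
have := NP N (leqnn _); rewrite ltr_pdivlMr// => gN.
have [GN _] := pP N.
have := inner_eq _ _ GN => iN.
have := Re_le _ _ GN; rewrite -iN.
have -> : complex.Re (inner (p N).1 g) =
    rnorm g ^+ 2 + complex.Re (inner ((p N).1 - g) g).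
  rewrite -[rnorm g ^+ 2]/(complex.Re (rnorm g ^+ 2)%:C) -inner_rnorm.
  by rewrite -ReD -innerDl addrC subrK.
have := Re_inner_le ((p N).1 - g) g; rewrite ler_norml => /andP[h1 _].
have : rnorm (p N).1 <= rnorm ((p N).1 - g) + rnorm g.
  by rewrite -[X in rnorm X <= _](subrK g) ler_rnormD.
nra.
Qed.

End Riesz.

(** * Positive semidefinite kernels and Schur's product theorem *)

Section PositiveSemidefinite.
Context {C : numClosedFieldType} {n : nat}.
Implicit Types (P Q : 'I_n -> 'I_n -> C) (c : 'I_n -> C).

Definition qform P c : C := \sum_i \sum_j c i * Num.conj (c j) * P i j.

Definition psd P : Prop :=
  (forall i j, P j i = Num.conj (P i j)) /\ (forall c, 0 <= qform P c).

(** The spectral theorem writes a positive semidefinite matrix as a combination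
    of rank-one kernels with coefficients its eigenvalues, each of which is a
    value of the quadratic form. *)
Lemma psd_spectral P : psd P ->
  exists (d : 'I_n -> C) (U : 'I_n -> 'I_n -> C), (forall k, 0 <= d k) /\
    forall i j, P i j = \sum_k d k * U k i * Num.conj (U k j).
Proof.
move=> [Pherm Ppos].
pose A : 'M[C]_n := \matrix_(i, j) P i j.
have Aherm : A \is hermsymmx.
  apply/is_hermitianmxP; rewrite expr0 scale1r.
  by apply/matrixP => i j; rewrite !mxE Pherm.
have /orthomx_spectralP AE := hermitian_normalmx Aherm.
set U := spectralmx A in AE; set d := spectral_diag A in AE.
have Uu : U \is unitarymx by exact: spectral_unitarymx.
have dE : diag_mx d = U *m A *m (U ^t Num.conj)%sesqui.
  rewrite AE invmx_unitary// !mulmxA mulmxtVK// -/U.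
  have /unitarymxP -> := Uu; first by rewrite mul1mx.
rewrite invmx_unitary// in AE.
exists (d 0), (fun k i => Num.conj (U k i)); split => [k|i j].
  have -> : d 0 k = (U *m A *m (U ^t Num.conj)%sesqui) k k.
    by rewrite -dE mxE eqxx.
  rewrite mxE; under eq_bigr do rewrite mxE mulr_suml.
  rewrite exchange_big /=.
  have := Ppos (U k); rewrite /qform; congr (0 <= _).
  by apply: eq_bigr => i _; apply: eq_bigr => j _; rewrite !mxE mulrAC.
have -> : P i j = A i j by rewrite mxE.
rewrite AE mxE; apply: eq_bigr => k _.
rewrite conjCK mul_mx_diag !mxE.
by rewrite [d 0 k * _]mulrC.
Qed.

(** Schur's product theorem: entrywise multiplication by the rank-one kernel
    [U k i * (U k j)^*] only rescales the coefficients in the quadratic form of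
    [Q]. *)
Lemma psdM P Q : psd P -> psd Q -> psd (fun i j => P i j * Q i j).
Proof.
move=> Ppsd [Qherm Qpos]; have [Pherm _] := Ppsd.
split=> [i j|c]; first by rewrite Pherm Qherm rmorphM.
have [d [U [d0 PE]]] := psd_spectral Ppsd.
have -> : qform (fun i j => P i j * Q i j) c =
    \sum_k d k * qform Q (fun i => c i * U k i).
  under [RHS]eq_bigr do rewrite /qform mulr_sumr.
  rewrite exchange_big; apply: eq_bigr => i _.
  under [RHS]eq_bigr do rewrite mulr_sumr.
  rewrite exchange_big; apply: eq_bigr => j _.
  rewrite PE mulr_suml mulr_sumr; apply: eq_bigr => k _.
  by rewrite rmorphM; ring.
by apply: sumr_ge0 => k _; rewrite mulr_ge0.
Qed.

Lemma psdD P Q : psd P -> psd Q -> psd (fun i j => P i j + Q i j).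
Proof.
move=> [Ph Pp] [Qh Qp]; split=> [i j|c]; first by rewrite Ph Qh rmorphD.
suff -> : qform (fun i j => P i j + Q i j) c = qform P c + qform Q c.
  by rewrite addr_ge0.
rewrite /qform -big_split; apply: eq_bigr => i _.
by rewrite -big_split; apply: eq_bigr => j _; rewrite mulrDr.
Qed.

Lemma psdZ (a : C) P : 0 <= a -> psd P -> psd (fun i j => a * P i j).
Proof.
move=> a0 [Ph Pp]; split=> [i j|c].
  by rewrite Ph rmorphM /= (CrealP (ger0_real a0)).
suff -> : qform (fun i j => a * P i j) c = a * qform P c by rewrite mulr_ge0.
rewrite /qform mulr_sumr; apply: eq_bigr => i _.
by rewrite mulr_sumr; apply: eq_bigr => j _; ring.
Qed.

(** The binomial expansion of [(1 + P)^m - 1] has positive coefficients; the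
    recurrence [(1 + P)^(m+1) - 1 = ((1 + P)^m - 1)(1 + P) + P] spares the sum. *)
Lemma psd_expr1D P m : psd P -> psd (fun i j => (1 + P i j) ^+ m - 1).
Proof.
move=> Ppsd; elim: m => [|m IH].
  split=> [i j|c]; first by rewrite !expr0 subrr rmorph0.
  by rewrite /qform; under eq_bigr do (under eq_bigr do rewrite expr0 subrr mulr0);
    rewrite sumr_ge0// => i _; rewrite sumr_ge0.
have -> : (fun i j => (1 + P i j) ^+ m.+1 - 1) =
  (fun i j => ((1 + P i j) ^+ m - 1) +
     (((1 + P i j) ^+ m - 1) * P i j + P i j)).
  by apply/funext => i; apply/funext => j; rewrite exprS; ring.
by apply: psdD => //; apply: psdD => //; exact: psdM.
Qed.

End PositiveSemidefinite.

(** * The complex exponential as a limit of powers *)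

Section ComplexExponential.
Context {R : realType}.
Implicit Types z : R[i].

Lemma cexp0 : cexp 0 = 1 :> R[i].
Proof. by rewrite /cexp /= expR0 cos0 sin0 mulr1 mulr0. Qed.

Lemma cexpD z1 z2 : cexp (z1 + z2) = cexp z1 * cexp z2.
Proof.
case: z1 z2 => a b [c d]; rewrite /cexp /= expRD cosD sinD.
by apply/eqP; rewrite eq_complex /=; apply/andP; split; apply/eqP; ring.
Qed.

Lemma cexpMn z n : cexp (z *+ n) = cexp z ^+ n.
Proof. by elim: n => [|n IH]; rewrite ?mulr0n ?cexp0 ?expr0// mulrS cexpD IH exprS. Qed.

Lemma norm_cexp z : `|cexp z| = (expR (complex.Re z))%:C.
Proof.
rewrite normc_def /cexp /=; congr (_ %:C).
by rewrite !exprMn -mulrDr cos2Dsin2 mulr1 sqrtr_sqr ger0_norm ?expR_ge0.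
Qed.

Lemma cexp_real (t : R) : cexp t%:C = (expR t)%:C.
Proof. by rewrite /cexp /= cos0 sin0 mulr1 mulr0. Qed.

(** The form in which differentiability at 0 enters [cexp_first_order]: an
    error [o(1 / n)] at the points [1 / (n + 1)]. *)
Lemma derive_inv_nat (g : R -> R) (l : R) : is_derive (0 : R) 1 g l ->
  forall e : R, 0 < e -> exists N, forall n, (N <= n)%N ->
    `|g n.+1%:R^-1 - g 0 - l * n.+1%:R^-1| <= e * n.+1%:R^-1.
Proof.
move=> [dg <-] e e0.
have /cvgrPdist_le /(_ e e0) := dg.
move=> [d /= d0 dP].
exists (Num.truncn d^-1) => n Nn.
have n0 : (0 : R) < n.+1%:R^-1 by rewrite invr_gt0 ltr0n.
have := dP n.+1%:R^-1; rewrite /= sub0r normrN gtr0_norm// => /(_ _ _).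
have -> : n.+1%:R^-1 < d.
  rewrite -ltf_pV2 ?posrE ?invr_gt0 ?ltr0n// invrK.
  by apply: lt_le_trans (truncnS_gt _) _; rewrite ler_nat.
move=> /(_ isT); rewrite gt_eqF// => /(_ isT).
rewrite addr0 [_ *: 1]mulr1 invrK => H.
rewrite -(@ler_pM2l _ n.+1%:R) ?ltr0n// [leRHS]mulrCA mulfV ?pnatr_eq0// mulr1.
rewrite -[X in X * _ <= _](@ger0_norm _ n.+1%:R) ?ler0n// -normrM.
apply: le_trans H; rewrite -[leRHS]normrN le_eqVlt; apply/orP; left; apply/eqP.
congr (`| _ |); rewrite opprB mulrBr mulrCA mulfV ?pnatr_eq0// mulr1.
by [].
Qed.

Lemma cexp_first_order z (e : R) : 0 < e -> exists N, forall n, (N <= n)%N ->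
  `|cexp (z / n.+1%:R) - (1 + z / n.+1%:R)| <= (e / n.+1%:R)%:C.
Proof.
case: z => a b e0.
have dg : is_derive (0 : R) 1 (fun t => expR (a * t) * cos (b * t)) a.
  apply: trigger_derive.
  by rewrite !mulr0 expR0 cos0 sin0 /GRing.scale /=; ring.
have dh : is_derive (0 : R) 1 (fun t => expR (a * t) * sin (b * t)) b.
  apply: trigger_derive.
  by rewrite !mulr0 expR0 cos0 sin0 /GRing.scale /=; ring.
have e20 : 0 < e / 2 by lra.
have [N1 N1P] := derive_inv_nat dg e20; have [N2 N2P] := derive_inv_nat dh e20.
exists (maxn N1 N2) => n; rewrite geq_max => /andP[/N1P + /N2P].
rewrite !mulr0 expR0 cos0 sin0 !mulr1 !mulr0 subr0.
have -> : (a +i* b) / n.+1%:R = (a / n.+1%:R) +i* (b / n.+1%:R).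
  have -> : n.+1%:R^-1 = (n.+1%:R^-1)%:C :> R[i] by rewrite fmorphV rmorph_nat.
  by apply/eqP; rewrite eq_complex /= !mulr0 subr0 add0r !eqxx.
set X := (X in `|X| <= _ -> _); set Y := (X in _ -> `|X| <= _ -> _) => Xe Ye.
have -> : cexp ((a / n.+1%:R) +i* (b / n.+1%:R)) -
    (1 + (a / n.+1%:R) +i* (b / n.+1%:R)) = X +i* Y.
  apply/eqP; rewrite eq_complex /=; apply/andP; split; apply/eqP.
    by rewrite /X; ring.
  by rewrite /Y; ring.
rewrite (complexE (X +i* Y)) /=; apply: le_trans (ler_normD _ _) _.
rewrite normrM norm_i mul1r !normc_def /= expr0n /= !addr0 !sqrtr_sqr -rmorphD lecR.
have := lerD Xe Ye; congr (_ <= _); field; by rewrite ?nat1r ?natr1 pnatr_eq0.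
Qed.

Lemma dist_expr_le (C : numDomainType) (x y r : C) n :
  `|x| <= r -> `|y| <= r ->
  `|x ^+ n.+1 - y ^+ n.+1| <= n.+1%:R * r ^+ n * `|x - y|.
Proof.
move=> xr yr; have r0 : 0 <= r := le_trans (normr_ge0 _) xr.
rewrite subrXX normrM mulrC ler_wpM2r//.
apply: le_trans (ler_norm_sum _ _ _) _.
rewrite -[n.+1 in leRHS]card_ord mulr_natl -sumr_const ler_sum// => i _.
rewrite normrM !normrX /=.
have ni : (i <= n)%N by rewrite -ltnS.
rewrite -[n in leRHS](subnK ni) exprD ler_pM ?exprn_ge0// lerXn2r ?nnegrE//.
Qed.

(** Compare [1 + z / n] with [cexp (z / n)], whose [n]-th power is [cexp z]:
    they differ by [o(1 / n)], and both have modulus at most [expR (|z| / n)],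
    so their [n]-th powers differ by [o(1)].  Powers of [1 + z / n] are what
    Schur's product theorem can handle. *)
Lemma cexp_limit z (e : R) : 0 < e -> exists N, forall n, (N <= n)%N ->
  `|(1 + z / n.+1%:R) ^+ n.+1 - cexp z| <= e%:C.
Proof.
move=> e0.
pose r := complex.Re `|z|.
have zr : `|z| = r%:C by rewrite RRe_real ?normr_real.
have r0 : 0 <= r by rewrite -ler0c -zr.
have [|N NP] := @cexp_first_order z (e / expR r).
  by rewrite divr_gt0 ?expR_gt0.
exists N => n /NP H.
have nC : n.+1%:R = n.+1%:R%:C :> R[i] by rewrite rmorph_nat.
have zn : `|z / n.+1%:R| = (r / n.+1%:R)%:C.
  by rewrite normf_div zr normr_nat nC -fmorphV -rmorphM.
have -> : cexp z = cexp (z / n.+1%:R) ^+ n.+1.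
  by rewrite -cexpMn -[X in _ = cexp X]mulr_natr divfK// pnatr_eq0.
have b1 : `|1 + z / n.+1%:R| <= (expR (r / n.+1%:R))%:C.
  apply: le_trans (ler_normD _ _) _.
  by rewrite normr1 zn -(rmorph1 (real_complex R)) -rmorphD lecR expR_ge1Dx.
have b2 : `|cexp (z / n.+1%:R)| <= (expR (r / n.+1%:R))%:C.
  rewrite norm_cexp lecR ler_expR -lecR -zn.
  by apply: le_trans (normc_ge_Re _); rewrite lecR ler_norm.
apply: le_trans (dist_expr_le _ b1 b2) _; rewrite distrC.
rewrite (le_trans (ler_wpM2l _ H))//.
  by rewrite mulr_ge0// exprn_ge0// ler0c expR_ge0.
rewrite nC -rmorphXn -!rmorphM lecR -expRM_natl.
rewrite [_ * (e / _ / _)]mulrC [n%:R * _]mulrC.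
have E0 : expR r != 0 by rewrite gt_eqF ?expR_gt0.
have : expR (r / n.+1%:R * n%:R) <= expR r.
  rewrite ler_expR mulrAC ler_pdivrMr ?ltr0n// ler_wpM2l// ler_nat.
  by [].
rewrite -(ler_pM2l e0) => He.
rewrite -(@ler_pM2r _ (expR r)) ?expR_gt0//.
apply: le_trans He.
rewrite le_eqVlt; apply/orP; left; apply/eqP; field.
by rewrite E0 /= ?nat1r pnatr_eq0.
Qed.

End ComplexExponential.

(** * Exponentials of positive semidefinite kernels *)

Section PsdExponential.
Context {R : realType} {n : nat}.
Implicit Types (P Q : 'I_n -> 'I_n -> R[i]).

Lemma ge0_closed (s : R[i]) :
  (forall e : R, 0 < e -> exists2 t, 0 <= t & `|t - s| <= e%:C) -> 0 <= s.
Proof.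
case: s => x y H.
have xy (e : R) : 0 < e -> - e <= x /\ `|y| <= e.
  move=> /H[[t t']]; rewrite lecE /= => /andP[/eqP -> t0] ts; split.
    have := le_trans (normc_ge_Re _) ts; rewrite lecR /= ler_norml => /andP[_].
    lra.
  have : `|complex.Re ('i%C * ((t +i* 0) - (x +i* y)))|%:C <= e%:C.
    apply: le_trans (normc_ge_Re _) _.
    by rewrite normrM norm_i mul1r.
  rewrite lecR /= mul0r !sub0r mul1r ?opprK ?normrN; exact.
have x0 : 0 <= x.
  by apply/ler_addgt0Pr => e /xy[]; lra.
have y0 : y = 0.
  apply/eqP; rewrite -normr_eq0 eq_le normr_ge0 andbT.
  by apply/ler_addgt0Pl => e /xy[]; rewrite addr0.
by rewrite y0 lecE /= eqxx x0.
Qed.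

Lemma psd_lim (P_ : nat -> 'I_n -> 'I_n -> R[i]) P :
  (forall i j, P j i = Num.conj (P i j)) ->
  (forall m, psd (P_ m)) ->
  (forall i j (e : R), 0 < e -> exists N, forall m, (N <= m)%N ->
    `|P_ m i j - P i j| <= e%:C) ->
  psd P.
Proof.
move=> Ph Pm Plim; split=> // c; apply: ge0_closed => e e0.
have SC0 : 0 <= \sum_i \sum_j `|c i| * `|c j|.
  by do 2![apply: sumr_ge0 => ? _]; rewrite mulr_ge0.
pose S : R := complex.Re (\sum_i \sum_j `|c i| * `|c j|).
have SE : \sum_i \sum_j `|c i| * `|c j| = S%:C by rewrite RRe_real// ger0_real.
have S0 : 0 <= S by rewrite -ler0c -SE.
(* S + 1 instead of S, which vanishes when c does. *)
have e1 : 0 < e / (S + 1) by rewrite divr_gt0// ltr_wpDl.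
have /choice[N NP] : forall ij : 'I_n * 'I_n, exists N, forall m, (N <= m)%N ->
    `|P_ m ij.1 ij.2 - P ij.1 ij.2| <= (e / (S + 1))%:C.
  by move=> ij; exact: Plim.
pose m := \max_ij N ij; exists (qform (P_ m) c); first by case: (Pm m).
have -> : qform (P_ m) c - qform P c =
    \sum_i \sum_j c i * Num.conj (c j) * (P_ m i j - P i j).
  rewrite /qform -sumrB; apply: eq_bigr => i _; rewrite -sumrB.
  by apply: eq_bigr => j _; rewrite mulrBr.
have : S%:C * (e / (S + 1))%:C <= e%:C.
  rewrite -rmorphM lecR mulrCA ger_pMr// ler_pdivrMr ?mul1r; last by rewrite ltr_wpDl.
  by rewrite lerDl.
apply: le_trans; rewrite -SE mulr_suml.
apply: le_trans (ler_norm_sum _ _ _) _; apply: ler_sum => i _.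
rewrite mulr_suml.
apply: le_trans (ler_norm_sum _ _ _) _; apply: ler_sum => j _.
rewrite !normrM norm_conjC ler_wpM2l ?mulr_ge0//.
by have := NP (i, j); apply; exact: leq_bigmax.
Qed.

Lemma cexp_conj (z : R[i]) : cexp (Num.conj z) = Num.conj (cexp z).
Proof.
by case: z => a b; apply/eqP; rewrite eq_complex /= cosN sinN mulrN !eqxx.
Qed.

(** By [cexp_limit] this is a limit of the kernels of [psd_expr1D]. *)
Lemma psd_cexp_sub1 P : psd P -> psd (fun i j => cexp (P i j) - 1).
Proof.
move=> Ppsd; have [Ph _] := Ppsd.
apply: (@psd_lim (fun m i j => (1 + m.+1%:R^-1 * P i j) ^+ m.+1 - 1))
  => [i j|m|i j e e0].
- by rewrite Ph cexp_conj rmorphB rmorph1.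
- by apply: psd_expr1D; apply: psdZ => //; rewrite invr_ge0 ler0n.
- have [N NP] := cexp_limit (P i j) e0; exists N => m /NP.
  by rewrite opprB addrA subrK [_^-1 * _]mulrC.
Qed.

(** Exponentiation is monotone for the positive semidefinite order, since
    [exp (P + Q) - exp Q = (exp P - 1) exp Q]. *)
Lemma psd_cexpD_sub P Q : psd P -> psd (fun i j => cexp (Q i j)) ->
  psd (fun i j => cexp (P i j + Q i j) - cexp (Q i j)).
Proof.
move=> /psd_cexp_sub1 Ppsd Qpsd.
have -> : (fun i j => cexp (P i j + Q i j) - cexp (Q i j)) =
   (fun i j => (cexp (P i j) - 1) * cexp (Q i j)).
  by apply/funext => i; apply/funext => j; rewrite cexpD mulrBl mul1r.
exact: psdM.
Qed.

End PsdExponential.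

(** * Bounded operators and their adjoints *)

Section Adjoints.
Context {R : realType} {U V : hilbertType R}.
Implicit Types T : U -> V.

Lemma linear_map0 T : linear T -> T 0 = 0.
Proof. by move=> Tl; have := Tl (-1) 0 0; rewrite addr0 scaler0 scaleN1r addNr. Qed.

Lemma linear_mapZ T a x : linear T -> T (a *: x) = a *: T x.
Proof. by move=> Tl; have := Tl a x 0; rewrite !addr0 linear_map0// addr0. Qed.

Lemma rnorm_eq0 (x : U) : rnorm x = 0 -> x = 0.
Proof. by move=> x0; apply/eqP; rewrite -normr_eq0 norm_rnorm x0. Qed.

Lemma opnorm_bound T (M : R) : linear T -> (opnorm T <= M%:E)%E ->
  forall x, rnorm (T x) <= M * rnorm x.
Proof.
move=> Tl TM x.
have [x0|x0] := eqVneq (rnorm x) 0.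
  by rewrite x0 (rnorm_eq0 x0) linear_map0// /rnorm normr0 mulr0.
have x1 : 0 < rnorm x by rewrite lt_def x0 rnorm_ge0.
rewrite -ler_pdivrMr// -lee_fin; apply: le_trans TM.
apply: ereal_sup_ubound; exists ((rnorm x)^-1%:C *: x) => /=.
  by rewrite norm_rnorm rnormZ gtr0_norm ?invr_gt0// mulVf.
congr (_ %:E).
by rewrite linear_mapZ// [LHS](rnormZ (rnorm x)^-1) gtr0_norm ?invr_gt0// mulrC.
Qed.

Lemma inner_ext (x y : U) : (forall z, inner z x = inner z y) -> x = y.
Proof.
move=> xy; apply/eqP; rewrite -subr_eq0 -normr_eq0 -sqrf_eq0 -inner_norm.
by rewrite innerDr innerNr xy subrr.
Qed.

Variables (T : U -> V) (M : R).
Hypotheses (Tlin : linear T) (M0 : 0 <= M)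
  (Tbnd : forall x, rnorm (T x) <= M * rnorm x).

(** The functional [x |-> <T x, y>] is bounded, so Riesz's theorem provides the
    adjoint that [adjoint] selects. *)
Lemma adjointE x y : inner (T x) y = inner x (adjoint T y).
Proof.
have /choice[S SP] : forall y, exists g, forall x, inner (T x) y = inner x g.
  move=> {}y.
  have [||a u l v m -> ->|u l ->|g [_ gP]] :=
    @riesz_graph _ _ (fun u l => l = inner (T u) y) (M * rnorm y).
  - by rewrite mulr_ge0 ?rnorm_ge0.
  - by rewrite linear_map0// inner0l.
  - by rewrite Tlin innerDl innerZl.
  - apply: le_trans (cauchy_schwarz _ _) _.
    rewrite !norm_rnorm -!rmorphM lecR mulrAC ler_wpM2r ?rnorm_ge0//.
  - by exists g => z; rewrite (gP z (inner (T z) y)).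
have /(_ (ex_intro _ S (fun x y => SP y x))) :=
  @xgetPex _ (fun=> 0) [set S | forall x y, inner (T x) y = inner x (S y)].
exact.
Qed.

Lemma adjointZ a y : adjoint T (a *: y) = a *: adjoint T y.
Proof. by apply: inner_ext => x; rewrite innerZr -!adjointE innerZr. Qed.

(** [|T^* y|^2 = <T (T^* y), y> <= M |T^* y| |y|]. *)
Lemma adjoint_bound y : rnorm (adjoint T y) <= M * rnorm y.
Proof.
have [->|S0] := eqVneq (rnorm (adjoint T y)) 0.
  by rewrite mulr_ge0 ?rnorm_ge0.
have S1 : 0 < rnorm (adjoint T y) by rewrite lt_def S0 rnorm_ge0.
rewrite -(ler_pM2r S1).
have -> : rnorm (adjoint T y) * rnorm (adjoint T y) =
    complex.Re (inner (T (adjoint T y)) y).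
  by rewrite adjointE inner_rnorm.
apply: le_trans (ler_norm _) _; apply: le_trans (Re_inner_le _ _) _.
by rewrite mulrAC ler_wpM2r ?rnorm_ge0.
Qed.

Lemma opnorm_adjoint_le : (opnorm (adjoint T) <= M%:E)%E.
Proof.
apply: ge_ereal_sup => _ [y /= y1 <-]; rewrite lee_fin.
apply: le_trans (adjoint_bound y) _.
by rewrite ler_piMr// -lecR -norm_rnorm.
Qed.

End Adjoints.

(** * Gram kernels *)

Section Gram.
Context {R : realType} {U : hilbertType R} {n : nat}.
Implicit Types (u : 'I_n -> U) (c : 'I_n -> R[i]).

Lemma inner_suml u x :
  inner (\sum_i u i) x = \sum_i inner (u i) x.
Proof.
exact: (big_morph (fun y => inner y x) (fun _ _ => innerDl _ _ _) (inner0l x)).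
Qed.

Lemma inner_sumr u x :
  inner x (\sum_i u i) = \sum_i inner x (u i).
Proof.
exact: (big_morph (fun y => inner x y) (fun _ _ => innerDr _ _ _) (inner0r x)).
Qed.

Lemma qform_gram u c : qform (fun i j => inner (u i) (u j)) c =
  (rnorm (\sum_i c i *: u i) ^+ 2)%:C.
Proof.
rewrite -inner_rnorm inner_suml; apply: eq_bigr => i _.
rewrite inner_sumr; apply: eq_bigr => j _.
by rewrite innerZl innerZr mulrA.
Qed.

Lemma qformB (P Q : 'I_n -> 'I_n -> R[i]) c :
  qform (fun i j => P i j - Q i j) c = qform P c - qform Q c.
Proof.
rewrite /qform -sumrB; apply: eq_bigr => i _; rewrite -sumrB.
by apply: eq_bigr => j _; rewrite mulrBr.
Qed.

Lemma psd_gram u : psd (fun i j => inner (u i) (u j)).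
Proof. by split=> [i j|c]; [exact: innerC|rewrite qform_gram ler0c sqr_ge0]. Qed.

End Gram.

Lemma psd_tr (C : numClosedFieldType) n (P : 'I_n -> 'I_n -> C) :
  psd P -> psd (fun i j => P j i).
Proof.
move=> [Ph Pp]; split=> [i j|c]; first exact: Ph.
have := Pp (fun i => Num.conj (c i)); congr (0 <= _).
rewrite /qform exchange_big; apply: eq_bigr => i _; apply: eq_bigr => j _.
by rewrite conjCK [c i * _]mulrC.
Qed.

(** The quadratic form is [|x|^2 - |A x|^2] with [x = \sum_i c i *: w i]. *)
Lemma psd_contraction_gram (R : realType) (U V : hilbertType R) (A : U -> V) n
    (w : 'I_n -> U) :
  linear A -> (forall x, rnorm (A x) <= rnorm x) ->
  psd (fun i j => inner (w i) (w j) - inner (A (w i)) (A (w j))).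
Proof.
move=> Alin Abnd; split=> [i j|c].
  by rewrite rmorphB /= (innerC (w i)) (innerC (A (w i))).
rewrite qformB !qform_gram -rmorphB ler0c subr_ge0.
rewrite ler_pXn2r ?nnegrE ?rnorm_ge0//.
suff -> : \sum_i c i *: A (w i) = A (\sum_i c i *: w i) by [].
rewrite (big_morph A (id1 := 0) (op1 := +%R)) ?linear_map0//.
  by apply: eq_bigr => i _; rewrite linear_mapZ.
by move=> x y; have := Alin 1 x y; rewrite !scale1r.
Qed.

(** * Composition operators on the Segal-Bargmann space *)

Section SegalBargmannComposition.
Context {R : realType} {E : hilbertType R} (H : segal_bargmann E).
Let K (w : E) : H := rkhs_kernel H w.

Lemma inner_kernel w z : inner (K w) (K z) = cexp (inner z w).
Proof. by rewrite rkhs_reproducing rkhs_kernelE. Qed.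

Lemma rnorm_kernel w : rnorm (K w) ^+ 2 = expR (rnorm w ^+ 2).
Proof. by apply: (@complexI R); rewrite -inner_rnorm inner_kernel inner_rnorm cexp_real. Qed.

Lemma rkhs_ext (f g : H) : (forall z, rkhs_eval f z = rkhs_eval g z) -> f = g.
Proof. by move=> fg; apply: rkhs_eval_inj; apply/funext. Qed.

Variables (phi A : E -> E) (b : E).
Hypotheses (phiE : forall z, phi z = A z + b) (Alin : linear A)
  (Abnd : forall x, rnorm (A x) <= rnorm x) (Ab : forall x, inner (A x) b = 0).

(** The norm of [C_phi^*], hence also of [C_phi]. *)
Let M := expR (rnorm b ^+ 2 / 2).

Let M0 : 0 <= M. Proof. exact: expR_ge0. Qed.

Lemma expR_half_sqr : M ^+ 2 = expR (rnorm b ^+ 2).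
Proof. by rewrite /M -expRM_natl; congr expR; field. Qed.

(** Orthogonality of [b] to the range of [A] removes the cross terms, so that
    the kernel at [phi x], [phi y] is a constant multiple of that at [A x],
    [A y]. *)
Lemma inner_phi x y :
  inner (phi x) (phi y) = inner (A x) (A y) + (rnorm b ^+ 2)%:C.
Proof.
rewrite !phiE innerDl !innerDr Ab (innerC (A y) b) Ab conjc0 inner_rnorm.
by rewrite addr0 add0r.
Qed.

(** The map [K_w |-> K_(phi w)], which is the future adjoint of [C_phi], is
    bounded by [M] on the span of the kernel functions.  The squared norms are
    quadratic forms of exponential kernels; with [P = <w_j, w_i> - <A w_j, A w_i>]
    and [Q = <A w_j, A w_i>] the claim is that [exp (P + Q) - exp Q] is positive
    semidefinite. *)
Lemma kernel_sum_bound n (c : 'I_n -> R[i]) (w : 'I_n -> E) :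
  rnorm (\sum_i c i *: K (phi (w i))) <= M * rnorm (\sum_i c i *: K (w i)).
Proof.
rewrite -(@ler_pXn2r _ 2) ?nnegrE ?rnorm_ge0 ?mulr_ge0 ?rnorm_ge0//.
rewrite exprMn expR_half_sqr.
suff : qform (fun i j => inner (K (phi (w i))) (K (phi (w j)))) c <=
    (expR (rnorm b ^+ 2))%:C * qform (fun i j => inner (K (w i)) (K (w j))) c.
  by rewrite !qform_gram -rmorphM lecR.
have -> : qform (fun i j => inner (K (phi (w i))) (K (phi (w j)))) c =
   (expR (rnorm b ^+ 2))%:C *
     qform (fun i j => inner (K (A (w i))) (K (A (w j)))) c.
  rewrite /qform mulr_sumr; apply: eq_bigr => i _; rewrite mulr_sumr.
  apply: eq_bigr => j _; rewrite !inner_kernel inner_phi cexpD cexp_real.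
  by rewrite [_ * (expR _)%:C]mulrC mulrCA.
rewrite ler_wpM2l ?ler0c ?expR_ge0// -subr_ge0 -qformB.
(* The transposition appears because <K_w, K_z> = exp <z, w>. *)
have Ppsd := psd_tr (psd_contraction_gram w Alin Abnd).
have Qpsd : psd (fun i j => cexp (inner (A (w j)) (A (w i)))).
  have := psd_gram (fun i => K (A (w i))); congr psd.
  by apply/funext => i; apply/funext => j; rewrite inner_kernel.
have [_ /(_ c)] := psd_cexpD_sub Ppsd Qpsd.
congr (0 <= qform _ c); apply/funext => i; apply/funext => j.
by rewrite subrK !inner_kernel.
Qed.

(** Combinations indexed by lists are added by concatenation and scaled by
    mapping, which is how the graph of [composition_exists] is seen to be
    linear. *)
Lemma kernel_seq_bound (s : seq (R[i] * E)) :
  rnorm (\sum_(p <- s) p.1 *: K (phi p.2)) <=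
    M * rnorm (\sum_(p <- s) p.1 *: K p.2).
Proof.
rewrite [X in rnorm X <= _]big_tnth [X in _ <= _ * rnorm X]big_tnth.
pose t := tnth (in_tuple s).
exact: (kernel_sum_bound (fun i => (t i).1) (fun i => (t i).2)).
Qed.

(** The function [f \o phi] is represented by the Riesz vector of the functional
    [K_w |-> <K_(phi w), f>] on the span of the kernel functions. *)
Lemma composition_exists (f : H) :
  exists g : H, rnorm g <= M * rnorm f /\ rkhs_eval g = rkhs_eval f \o phi.
Proof.
pose G (u : H) (l : R[i]) := exists s : seq (R[i] * E),
  u = \sum_(p <- s) p.1 *: K p.2 /\ l = inner (\sum_(p <- s) p.1 *: K (phi p.2)) f.
have [||a u l v m|u l|g [gM gP]] := @riesz_graph _ _ G (M * rnorm f).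
- by rewrite mulr_ge0 ?rnorm_ge0.
- by exists [::]; rewrite !big_nil inner0l.
- move=> [s [-> ->]] [t [-> ->]].
  exists ([seq (a * p.1, p.2) | p <- s] ++ t); rewrite !big_cat !big_map /=.
  rewrite innerDl -innerZl !scaler_sumr.
  by split; [congr (_ + _)|congr (inner _ _ + _)]; apply: eq_bigr => p _;
    rewrite scalerA.
- move=> [s [-> ->]]; apply: le_trans (cauchy_schwarz _ _) _.
  by rewrite !norm_rnorm -!rmorphM lecR mulrAC ler_wpM2r ?rnorm_ge0 ?kernel_seq_bound.
exists g; split=> //; apply/funext => w /=.
rewrite -!rkhs_reproducing innerC [RHS]innerC; congr (_^*)%C.
by apply: gP; exists [:: (1, w)]; rewrite !big_seq1 !scale1r.
Qed.

Let Cphi : H -> H := composition_op H phi.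

Lemma composition_opE (f : H) z : rkhs_eval (Cphi f) z = rkhs_eval f (phi z).
Proof.
have [g [_ gE]] := composition_exists f.
pose G := [set g : H | rkhs_eval g = rkhs_eval f \o phi].
have := @xgetPex _ 0 G (ex_intro _ g gE).
by rewrite /Cphi /composition_op => /= ->.
Qed.

Lemma composition_op_linear : linear Cphi.
Proof.
by move=> a f g; apply: rkhs_ext => z; rewrite !(composition_opE, rkhs_eval_linear).
Qed.

Lemma composition_op_bound (f : H) : rnorm (Cphi f) <= M * rnorm f.
Proof.
have [g [gM gE]] := composition_exists f.
suff -> : Cphi f = g by [].
by apply: rkhs_ext => z; rewrite composition_opE gE.
Qed.

Let CphiE := adjointE composition_op_linear M0 composition_op_bound.

Lemma adjoint_composition_kernel w : adjoint Cphi (K w) = K (phi w).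
Proof.
apply: inner_ext => f; rewrite -CphiE.
by rewrite !rkhs_reproducing composition_opE.
Qed.

Lemma rnorm_adjoint_composition w :
  rnorm (adjoint Cphi (normalized_kernel H w)) ^+ 2 =
  expR (rnorm (A w) ^+ 2 + rnorm b ^+ 2 - rnorm w ^+ 2).
Proof.
rewrite /normalized_kernel (adjointZ composition_op_linear M0 composition_op_bound).
rewrite -/(K w) adjoint_composition_kernel norm_rnorm -fmorphV rnormZ exprMn.
rewrite real_normK ?num_real// exprVn !rnorm_kernel -expRN -expRD; congr expR.
rewrite addrC; congr (_ + _); apply: (@complexI R).
by rewrite -inner_rnorm inner_phi inner_rnorm rmorphD.
Qed.

Lemma rnorm_normalized_kernel w : rnorm (normalized_kernel H w) = 1.
Proof.
rewrite /normalized_kernel norm_rnorm -fmorphV rnormZ ger0_norm ?invr_ge0 ?rnorm_ge0//.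
rewrite mulVf//; apply/eqP => K0; have := rnorm_kernel w; rewrite /K K0 expr0n /=.
by move=> /esym/eqP; rewrite expR_eq0.
Qed.

(** The bound [M] is reached at [K_0], which has norm 1 and is sent to [K_b]. *)
Lemma opnorm_adjoint_composition : opnorm (adjoint Cphi) = M%:E.
Proof.
apply/eqP; rewrite eq_le.
rewrite (opnorm_adjoint_le composition_op_linear M0 composition_op_bound) /=.
apply: ereal_sup_ubound; exists (normalized_kernel H 0) => /=.
  by rewrite norm_rnorm rnorm_normalized_kernel.
congr (_ %:E); apply/eqP; rewrite -/(rnorm _).
rewrite -(@eqrXn2 _ 2) ?rnorm_ge0 //.
rewrite rnorm_adjoint_composition expR_half_sqr linear_map0//.
by rewrite /rnorm !normr0 /= expr0n /= add0r subr0.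
Qed.

(** Both sides compare exponents: [|A w|^2 + |b|^2 - |w|^2] for the squared norm
    of [C_phi^* k_w], and [|b|^2] for the squared operator norm. *)
Lemma attains_norm_adjoint_composition w :
  attains_norm (adjoint Cphi) (normalized_kernel H w) <-> rnorm (A w) = rnorm w.
Proof.
rewrite /attains_norm opnorm_adjoint_composition norm_rnorm rnorm_normalized_kernel.
rewrite -[complex.Re _]/(rnorm _).
have key : (rnorm (adjoint Cphi (normalized_kernel H w)) == M) =
    (rnorm (A w) == rnorm w).
  rewrite -(@eqrXn2 _ 2) ?rnorm_ge0 // rnorm_adjoint_composition expR_half_sqr.
  rewrite (inj_eq (@expR_inj R)) -(@eqrXn2 _ 2 (rnorm (A w))) ?rnorm_ge0//.
  by rewrite addrAC -subr_eq0 addrK subr_eq0.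
split=> [[_ [/eqP]]|/eqP]; first by rewrite key => /eqP.
by rewrite -key => /eqP ->.
Qed.

End SegalBargmannComposition.

Theorem theorem3p3 (R : realType) (E : hilbertType R) (H : segal_bargmann E)
    (phi A : E -> E) (b w0 : E) :
  property_P phi A b -> adjoint A b = 0 -> `|w0| = 1 ->
  (attains_norm A w0 /\ opnorm A = 1%E) <->
  attains_norm (adjoint (composition_op H phi)) (normalized_kernel H w0).
Proof.
move=> [phiE [[Alin _] A1] _] Ab w01.
have Abnd x : rnorm (A x) <= 1 * rnorm x by exact: opnorm_bound.
have Abnd1 x : rnorm (A x) <= rnorm x by rewrite -[leRHS]mul1r.
have Ab0 x : inner (A x) b = 0 by rewrite (adjointE Alin ler01 Abnd) Ab inner0r.
have r1 : rnorm w0 = 1 by rewrite /rnorm w01.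
rewrite (attains_norm_adjoint_composition H phiE Alin Abnd1 Ab0) r1.
split=> [[[_ Aw0] Aop]|Aw0].
  by move: Aw0; rewrite Aop => -[].
have Aop : opnorm A = 1%E.
  apply/eqP; rewrite eq_le A1 /=.
  by apply: ereal_sup_ubound; exists w0; rewrite /= ?w01// -/(rnorm _) Aw0.
by rewrite /attains_norm Aop; split=> //; split=> //; rewrite -/(rnorm _) Aw0.
Qed.
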